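(* Let $V$ be an $m\times n$ $(0,1)$-matrix and $B$ a $p\times q$ $(0,1)$-matrix, let $L=\begin{bmatrix}0 & V\\ V^T & 0\end{bmatrix}$, $H=\begin{bmatrix}0 & B\\ B^T & 0\end{bmatrix}$, $H^{\#}=\begin{bmatrix}0 & B^T\\ B & 0\end{bmatrix}$, and suppose the bipartite graphs $G_L$ and $G_H$ have no isolated vertices. If $G_L$ is a non-empty $(k,l)$-biregular bipartite graph with $k\neq l$, then $G_L$ and $G_H$ have property $\eta$.
   Context: For a symmetric $(0,1)$-matrix $A$ with zero diagonal, $G_A$ is the simple graph with adjacency matrix $A$; so $G_L$ (resp. $G_H$) is the bipartite graph with biadjacency matrix $V$ (resp. $B$), whose partite sets are indexed by the rows and by the columns of $V$ (resp. $B$). A bipartite graph is $(k,l)$-biregular if every vertex in one partite set has degree $k$ and every vertex in the other partite set has degree $l$. The partitioned tensor product of $2\times 2$ block matrices is $\begin{bmatrix}U & V'\\ W & X\end{bmatrix}\underline{\otimes}\begin{bmatrix}A & B'\\ C & D\end{bmatrix}=\begin{bmatrix}U\otimes A & V'\otimes B'\\ W\otimes C & X\otimes D\end{bmatrix}$ ($\otimes$ the Kronecker product), so $L\underline{\otimes}H=\begin{bmatrix}0 & V\otimes B\\ V^T\otimes B^T & 0\end{bmatrix}$ and $L\underline{\otimes}H^{\#}=\begin{bmatrix}0 & V\otimes B^T\\ V^T\otimes B & 0\end{bmatrix}$. The canonical bipartition of $G_{L\underline{\otimes}H}$ is $X_1\cup Y_1$, with $X_1$ the first $mp$ vertices (rows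 of $V\otimes B$) and $Y_1$ the last $nq$ vertices; that of $G_{L\underline{\otimes}H^{\#}}$ is $X_2\cup Y_2$, with $X_2$ the first $mq$ vertices (rows of $V\otimes B^T$) and $Y_2$ the last $np$ vertices. An isomorphism $f$ from $G_{L\underline{\otimes}H}$ to $G_{L\underline{\otimes}H^{\#}}$ respects the partite sets if either $f(X_1)=X_2,f(Y_1)=Y_2$ or $f(X_1)=Y_2,f(Y_1)=X_2$. The graphs $G_L$ and $G_H$ have property $\eta$ if, whenever $G_{L\underline{\otimes}H}$ and $G_{L\underline{\otimes}H^{\#}}$ are isomorphic, there exists an isomorphism between them that respects the partite sets of the canonical bipartitions. *)

(* Defs.v *)
From mathcomp Require Import all_boot all_order all_algebra.
From mathcomp Require Export mxtens.

Set Implicit Arguments.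
Unset Strict Implicit.
Unset Printing Implicit Defensive.

Import GRing.Theory.
Local Open Scope ring_scope.

Definition zero_one_mx m n (A : 'M[int]_(m, n)) : bool :=
  [forall i, forall j, (A i j == 0) || (A i j == 1)].

(* [graph_of A] is the edge relation of G_A; it is only used for adjacency
   matrices, i.e. matrices satisfying [adjacency_mx] (see [adjacency_biadj_mx],
   [adjacency_ptens] and [adjacency_ptens_sharp] below). *)
Definition adjacency_mx N (A : 'M[int]_N) : bool :=
  [&& A^T == A, zero_one_mx A & [forall i, A i i == 0]].

Definition graph_of N (A : 'M[int]_N) : rel 'I_N := [rel x y | A x y == 1].

Definition degree (T : finType) (e : rel T) (x : T) : nat := #|[set y | e x y]|.

Definition no_isolated (T : finType) (e : rel T) : Prop :=
  forall x, exists y, e x y.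

Definition nonempty_graph (T : finType) (e : rel T) : Prop :=
  exists x y, e x y.

Definition biregular_on (T : finType) (e : rel T) (X Y : {set T}) (k l : nat)
    : Prop :=
  (forall x, x \in X -> degree e x = k) /\ (forall y, y \in Y -> degree e y = l).

(* The statement "one partite set has degree k and the other one degree l"
   does not say which one is which. *)
Definition biregular (T : finType) (e : rel T) (X Y : {set T}) (k l : nat)
    : Prop :=
  biregular_on e X Y k l \/ biregular_on e Y X k l.

Definition is_graph_iso (T U : finType) (e : rel T) (e' : rel U) (f : T -> U)
    : Prop :=
  bijective f /\ forall x y, e' (f x) (f y) = e x y.

Definition respects_parts (T U : finType) (X1 Y1 : {set T}) (X2 Y2 : {set U})
    (f : T -> U) : Prop :=
  (f @: X1 = X2 /\ f @: Y1 = Y2) \/ (f @: X1 = Y2 /\ f @: Y1 = X2).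

Definition row_part (a b : nat) : {set 'I_(a + b)} :=
  [set lshift b i | i : 'I_a].
Definition col_part (a b : nat) : {set 'I_(a + b)} :=
  [set rshift a j | j : 'I_b].

Definition biadj_mx m n (V : 'M[int]_(m, n)) : 'M[int]_(m + n) :=
  block_mx 0 V V^T 0.

Definition biadj_sharp_mx p q (B : 'M[int]_(p, q)) : 'M[int]_(q + p) :=
  block_mx 0 B^T B 0.

(* Partitioned tensor product; [*t] is the Kronecker product [tensmx]. *)
Definition ptens m1 m2 n1 n2 p1 p2 q1 q2
    (M : 'M[int]_(m1 + m2, n1 + n2)) (N : 'M[int]_(p1 + p2, q1 + q2)) :
    'M[int]_(m1 * p1 + m2 * p2, n1 * q1 + n2 * q2) :=
  block_mx (ulsubmx M *t ulsubmx N) (ursubmx M *t ursubmx N)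
           (dlsubmx M *t dlsubmx N) (drsubmx M *t drsubmx N).

Definition property_eta m n p q (V : 'M[int]_(m, n)) (B : 'M[int]_(p, q))
    : Prop :=
  let G1 := graph_of (ptens (biadj_mx V) (biadj_mx B)) in
  let G2 := graph_of (ptens (biadj_mx V) (biadj_sharp_mx B)) in
  (exists f, is_graph_iso G1 G2 f) ->
  exists f, is_graph_iso G1 G2 f /\
    respects_parts (row_part (m * p) (n * q)) (col_part (m * p) (n * q))
                   (row_part (m * q) (n * p)) (col_part (m * q) (n * p)) f.

Lemma ptens_biadj m n p q (V : 'M[int]_(m, n)) (B : 'M[int]_(p, q)) :
  ptens (biadj_mx V) (biadj_mx B) = biadj_mx (V *t B).
Proof.
rewrite /ptens /biadj_mx !block_mxKul !block_mxKur !block_mxKdl !block_mxKdr.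
by rewrite trmx_tens; congr block_mx; apply/matrixP=> i j; rewrite !mxE mul0r.
Qed.

Lemma ptens_biadj_sharp m n p q (V : 'M[int]_(m, n)) (B : 'M[int]_(p, q)) :
  ptens (biadj_mx V) (biadj_sharp_mx B) = biadj_mx (V *t B^T).
Proof.
rewrite /ptens /biadj_mx /biadj_sharp_mx.
rewrite !block_mxKul !block_mxKur !block_mxKdl !block_mxKdr trmx_tens trmxK.
by congr block_mx; apply/matrixP=> i j; rewrite !mxE mul0r.
Qed.

Lemma zero_one_tr m n (V : 'M[int]_(m, n)) : zero_one_mx V -> zero_one_mx V^T.
Proof.
move=> /'forall_forallP V01; apply/'forall_forallP=> i j.
by rewrite mxE; apply: V01.
Qed.

Lemma zero_one_tens m n p q (V : 'M[int]_(m, n)) (B : 'M[int]_(p, q)) :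
  zero_one_mx V -> zero_one_mx B -> zero_one_mx (V *t B).
Proof.
move=> /'forall_forallP V01 /'forall_forallP B01; apply/'forall_forallP=> i j.
rewrite mxE; case/orP: (V01 (mxtens_unindex i).1 (mxtens_unindex j).1) => /eqP->.
  by rewrite mul0r.
by rewrite mul1r; apply: B01.
Qed.

Lemma adjacency_biadj_mx m n (V : 'M[int]_(m, n)) :
  zero_one_mx V -> adjacency_mx (biadj_mx V).
Proof.
move=> /'forall_forallP V01; apply/and3P; split.
- by rewrite /biadj_mx tr_block_mx !trmx0 trmxK.
- apply/'forall_forallP=> i j; rewrite /biadj_mx.
  case: (split_ordP i) => a ->; case: (split_ordP j) => b ->.
  + by rewrite block_mxEul mxE.
  + by rewrite block_mxEur; apply: V01.
  + by rewrite block_mxEdl mxE; apply: V01.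
  + by rewrite block_mxEdr mxE.
- apply/forallP=> i; rewrite /biadj_mx.
  by case: (split_ordP i) => a ->; rewrite ?block_mxEul ?block_mxEdr mxE.
Qed.

Lemma adjacency_ptens m n p q (V : 'M[int]_(m, n)) (B : 'M[int]_(p, q)) :
  zero_one_mx V -> zero_one_mx B ->
  adjacency_mx (ptens (biadj_mx V) (biadj_mx B)).
Proof.
by move=> V01 B01; rewrite ptens_biadj; exact/adjacency_biadj_mx/zero_one_tens.
Qed.

Lemma adjacency_ptens_sharp m n p q (V : 'M[int]_(m, n)) (B : 'M[int]_(p, q)) :
  zero_one_mx V -> zero_one_mx B ->
  adjacency_mx (ptens (biadj_mx V) (biadj_sharp_mx B)).
Proof.
move=> V01 B01; rewrite ptens_biadj_sharp.
exact/adjacency_biadj_mx/zero_one_tens/zero_one_tr.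
Qed.

(* Main.v *)
(* Colour the vertices of [G_L] and [G_H] by their sides.  Both product graphs
   live in the direct product of [G_L] and [G_H], on the pairs of equal,
   resp. opposite, colours.  For a connected coloured graph F with a marked
   vertex u, counting the homomorphisms from F to the two (isomorphic) products
   for which the image of u has a given degree yields, by descent on the degree
   (this is where k <> l enters), that F has as many colour-preserving as
   colour-reversing homomorphisms to [G_H].  By multiplicativity this holds for
   every F, and Lovasz' argument (sorting homomorphisms by their kernel) gives
   it for injective homomorphisms.  With F = [G_H] this yields a
   colour-reversing automorphism s of [G_H], and (x, y) |-> (x, s y) is the
   required isomorphism. *)
Require Import Defs.
From mathcomp Require Import all_boot all_order all_algebra.

Set Implicit Arguments.
Unset Strict Implicit.
Unset Printing Implicit Defensive.

(** * Homomorphisms with a prescribed colouring *)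

Definition proper_coloring (T : finType) (e : rel T) (c : T -> bool) : Prop :=
  forall x y, e x y -> c y = ~~ c x.

Definition flip (T : Type) (c : T -> bool) : T -> bool := fun x => ~~ c x.

Section ColorHoms.
Variables (T W : finType) (e : rel T) (r : rel W) (col : W -> bool).

Definition color_homs (c : T -> bool) : {set {ffun T -> W}} :=
  [set f : {ffun T -> W} | [forall x, forall y, e x y ==> r (f x) (f y)]
                           && [forall x, col (f x) == c x]].

Lemma color_homsP c (f : {ffun T -> W}) :
  reflect ((forall x y, e x y -> r (f x) (f y)) /\ (forall x, col (f x) = c x))
          (f \in color_homs c).
Proof.
rewrite inE; apply: (iffP andP) => [[/'forall_forallP h1 /forallP h2]|[h1 h2]].
  by split=> [x y|x]; [apply/implyP/h1 | apply/eqP].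
split; first by apply/'forall_forallP=> x y; apply/implyP/h1.
by apply/forallP=> x; apply/eqP.
Qed.

Lemma eq_color_homs c c' : c =1 c' -> color_homs c = color_homs c'.
Proof.
move=> cc'; apply/setP=> f.
by apply/color_homsP/color_homsP=> -[h1 h2]; split=> // x; rewrite h2 cc'.
Qed.

Lemma color_homs_proper c f :
  proper_coloring r col -> f \in color_homs c -> proper_coloring e c.
Proof. by move=> pr /color_homsP[h1 h2] x y /h1/pr; rewrite !h2. Qed.

End ColorHoms.

(** A properly coloured graph folds onto a single edge of the target, each colour class going to the
    end of its colour. This provides the nonzero factor to cancel later. *)
Lemma color_homs_gt0 (T W : finType) (e : rel T) (r : rel W) (col : W -> bool) c w w' :
  proper_coloring e c -> symmetric r -> r w w' -> col w -> ~~ col w' ->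
  0 < #|color_homs e r col c|.
Proof.
move=> pc rs rww' cw /negbTE cw'; apply/card_gt0P.
exists [ffun x => if c x then w else w']; apply/color_homsP; split=> [x y exy|x].
  by rewrite !ffunE (pc _ _ exy); case: (c x); rewrite //= rs.
by rewrite ffunE; case: (c x).
Qed.

(** * Multiplicativity over disjoint unions *)

Section Split.
Variables (T W : finType) (e : rel T) (r : rel W) (col : W -> bool).
Variables (c : T -> bool) (P : pred T).
Hypothesis closedP : forall x y, e x y -> P x = P y.

Let T1 := {x | P x}.
Let T2 := {x | ~~ P x}.
Let e1 : rel T1 := fun x y => e (val x) (val y).
Let e2 : rel T2 := fun x y => e (val x) (val y).

(** No edge joins [P] to its complement, so restricting to the two sides is a bijection onto pairs
    of homomorphisms. *)
Lemma card_color_homs_split :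
  #|color_homs e r col c| =
  #|color_homs e1 r col (c \o val)| * #|color_homs e2 r col (c \o val)|.
Proof.
pose h (f : {ffun T -> W}) :=
  ([ffun x : T1 => f (val x)], [ffun x : T2 => f (val x)]).
have h_inj : injective h.
  move=> f g [/ffunP h1 /ffunP h2]; apply/ffunP=> x.
  case: (boolP (P x)) => Px.
    by have := h1 (exist _ x Px); rewrite !ffunE.
  by have := h2 (exist _ x Px); rewrite !ffunE.
rewrite -cardsX -(card_imset _ h_inj); apply: eq_card => -[g1 g2].
apply/imsetP/setXP => [[f /color_homsP[h1 h2] [-> ->]]|].
  by split; apply/color_homsP; split=> [x y exy|x]; rewrite !ffunE;
     first [exact: h1 | exact: h2].
move=> [/color_homsP[a1 a2] /color_homsP[b1 b2]].
(* [decP] supplies the proof of [P x] or of its negation that is needed to form an element of [T1]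
   or [T2]; [glue1] and [glue2] remove the dependence on that proof. *)
pose glue x := match decP (@idP (P x)) with
  | left p => g1 (exist _ x p)
  | right p => g2 (exist _ x (introN idP p)) end.
have glue1 x (p : P x) : glue x = g1 (exist _ x p).
  rewrite /glue; case: decP => [p'|//].
  by congr (g1 _); apply: val_inj.
have glue2 x (p : ~~ P x) : glue x = g2 (exist _ x p).
  rewrite /glue; case: decP => [p'|p']; first by case/negP: p.
  by congr (g2 _); apply: val_inj.
exists [ffun x => glue x].
  apply/color_homsP; split=> [x y exy|x]; rewrite !ffunE.
    have Pxy := closedP exy; case: (boolP (P x)) => Px.
      have Py : P y by rewrite -Pxy.
      by rewrite (glue1 _ Px) (glue1 _ Py); apply: a1.
    have Py : ~~ P y by rewrite -Pxy.
    by rewrite (glue2 _ Px) (glue2 _ Py); apply: b1.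
  case: (boolP (P x)) => Px.
    by rewrite (glue1 _ Px) a2.
  by rewrite (glue2 _ Px) b2.
by congr (_, _); apply/ffunP=> -[x Px]; rewrite !ffunE /= ?(glue1 _ Px) ?(glue2 _ Px).
Qed.

End Split.

(** * Kernels, quotient graphs and injective homomorphisms *)

Section Kernel.
Variables (T W : finType) (e : rel T) (r : rel W) (col : W -> bool).

(* The kernel of a map is encoded by a choice of representatives of its
   fibres. *)
Definition fiber_rep (f : {ffun T -> W}) : {ffun T -> T} :=
  [ffun x => odflt x [pick y | f y == f x]].

Lemma fiber_repK (f : {ffun T -> W}) x : f (fiber_rep f x) = f x.
Proof.
by rewrite ffunE; case: pickP => [y /eqP//|/(_ x)]; rewrite eqxx.
Qed.

Lemma eq_fiber_rep (f g : {ffun T -> W}) x y :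
  (forall z, (f z == f x) = (g z == g y)) -> fiber_rep f x = fiber_rep g y.
Proof.
move=> fg; rewrite !ffunE (eq_pick fg).
(* The two defaults [x] and [y] may differ, but they are never returned: [y] lies in its own
   fibre. *)
case: pickP => // /(_ y); by rewrite eqxx.
Qed.

Lemma fiber_rep_eq (f : {ffun T -> W}) x y : (fiber_rep f x == fiber_rep f y) = (f x == f y).
Proof.
apply/eqP/eqP => [fxy|fxy]; first by rewrite -fiber_repK fxy fiber_repK.
by apply: eq_fiber_rep => z; rewrite fxy.
Qed.

Definition kernel_homs (c : T -> bool) (k : {ffun T -> T}) :=
  [set f in color_homs e r col c | fiber_rep f == k].

Lemma card_color_homs_kernel c :
  #|color_homs e r col c| = \sum_k #|kernel_homs c k|.
Proof.
rewrite -sum1_card (partition_big fiber_rep xpredT) //=.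
by apply: eq_bigr => k _; rewrite -sum1_card; apply: eq_bigl => f; rewrite [RHS]inE.
Qed.

(** The identity encodes the trivial kernel: a representative shares the value of its point, so
    injectivity forces it to be that point. *)
Lemma kernel_homs1P c f :
  reflect (f \in color_homs e r col c /\ injective f)
          (f \in kernel_homs c [ffun x => x]).
Proof.
rewrite [X in reflect _ X]inE; apply: (iffP andP) => -[fc].
  move=> /eqP/ffunP f1; split=> // x y /eqP; rewrite -fiber_rep_eq => /eqP.
  by rewrite !f1 !ffunE.
move=> fi; split=> //; apply/eqP/ffunP=> x; apply: fi.
by rewrite fiber_repK ffunE.
Qed.

Section Quotient.
Variables (k : {ffun T -> T}).

(** The quotient graph by [k]: the fixed points of [k] stand for the classes, and its edges are the
    images of the edges of [e]. *)
Definition quot := {x | k x == x}.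
Definition quot_rel : rel quot := fun u v =>
  [exists x, exists y, [&& k x == val u, k y == val v & e x y]].

Lemma card_quot_lt : k != [ffun x => x] -> #|{: quot}| < #|T|.
Proof.
move=> k1; rewrite card_sig; apply: proper_card.
rewrite properE subset_predT /=; apply: contra k1 => /subsetP sub.
by apply/eqP/ffunP=> x; rewrite ffunE; apply/eqP/(sub x).
Qed.

End Quotient.
End Kernel.

(** Homomorphisms with kernel [k] factor uniquely through the quotient, where they become injective.
    The factor is found by restricting to representatives; conversely [g] is pulled back along [x]
    to [k x], which keeps colours because [c] is constant on classes. *)
Lemma card_kernel_homs (T W : finType) (e : rel T) (r : rel W) (col : W -> bool) c
    (f0 : {ffun T -> W}) (k := fiber_rep f0) :
  (forall x, c (k x) = c x) ->
  #|kernel_homs e r col c k| =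
  #|kernel_homs (@quot_rel _ e k) r col (c \o val) [ffun x => x]|.
Proof.
move=> ck.
(* Idempotence comes from [k] being the kernel of an actual map [f0]. *)
have kk x : k (k x) == k x by rewrite /k fiber_rep_eq fiber_repK.
pose h (f : {ffun T -> W}) : {ffun quot k -> W} := [ffun x => f (val x)].
have h_inj : {in kernel_homs e r col c k &, injective h}.
  move=> f g; rewrite !inE => /andP[_ /eqP fk] /andP[_ /eqP gk] /ffunP hfg.
  apply/ffunP=> x; rewrite -[LHS]fiber_repK -[RHS]fiber_repK fk gk.
  by move: (hfg (exist _ (k x) (kk x))); rewrite [LHS]ffunE [RHS]ffunE.
rewrite -(card_in_imset h_inj); apply: eq_card => g.
apply/imsetP/kernel_homs1P => [[f]|[/color_homsP[g1 g2] gi]].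
  rewrite inE => /andP[/color_homsP[f1 f2] /eqP fk] ->; split.
    apply/color_homsP; split=> [u v|u]; rewrite !ffunE ?f2 //.
    case/existsP=> x /existsP[y /and3P[/eqP<- /eqP<- /f1]].
    by rewrite -fk !fiber_repK.
  move=> [u pu] [v pv]; rewrite !ffunE /= => /eqP.
  rewrite -fiber_rep_eq fk (eqP pu) (eqP pv) => /eqP uv.
  exact: val_inj.
pose q x : quot k := exist _ (k x) (kk x).
exists [ffun x => g (q x)].
  rewrite inE; apply/andP; split.
    apply/color_homsP; split=> [x y exy|x]; rewrite !ffunE.
      by apply: g1; apply/existsP; exists x; apply/existsP; exists y; rewrite !eqxx.
    by rewrite g2 /= ck.
  apply/eqP/ffunP=> x; apply: eq_fiber_rep => z.
  by rewrite !ffunE (inj_eq gi) -val_eqE /= fiber_rep_eq.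
apply/ffunP=> u; rewrite !ffunE; congr (g _); apply: val_inj => /=.
by apply/esym/eqP; case: u.
Qed.

(** Induction on the number of vertices. Sort both totals by kernel: a nontrivial kernel counts
    injective homomorphisms from a smaller quotient, so these terms agree, and cancelling them
    leaves the injective ones. *)
Lemma color_homs_flip_inj (W : finType) (r : rel W) (col : W -> bool) :
  (forall (T : finType) (e : rel T) c,
     #|color_homs e r col c| = #|color_homs e r col (flip c)|) ->
  forall (T : finType) (e : rel T) c,
    #|kernel_homs e r col c [ffun x => x]| =
    #|kernel_homs e r col (flip c) [ffun x => x]|.
Proof.
move=> hom_eq T; have [N] := ubnP #|T|; elim: N T => // N IH T ltTN e c.
have := hom_eq T e c; rewrite !card_color_homs_kernel.
rewrite (bigD1 [ffun x => x]) //= [RHS](bigD1 [ffun x => x]) //=.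
rewrite [X in _ + X = _](_ : _ =
  \sum_(k | k != [ffun x => x]) #|kernel_homs e r col (flip c) k|).
  exact: addIn.
apply: eq_bigr => k k1.
(* A kernel that no map realises, or that merges vertices of different colours, contributes nothing
   to either side. *)
have [/existsP[f0 /andP[/eqP f0k /forallP ck]]|nok] :=
    boolP [exists f : {ffun T -> W}, (fiber_rep f == k) && [forall x, c (k x) == c x]].
  rewrite -{}f0k in k1 ck *.
  rewrite !card_kernel_homs => [|x|x]; first last.
  - by rewrite /flip (eqP (ck x)).
  - exact/eqP.
  apply: IH; apply: leq_trans (card_quot_lt k1) _; exact: ltTN.
have empty c' : (forall x, (c' (k x) == c' x) = (c (k x) == c x)) ->
    kernel_homs e r col c' k = set0.
  move=> cc'; apply/setP=> f; rewrite [RHS]inE; apply: contraNF nok.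
  rewrite inE => /andP[/color_homsP[_ f2] /eqP fk]; apply/existsP; exists f.
  rewrite fk eqxx; apply/forallP=> x.
  by rewrite -cc' -!f2 -fk fiber_repK.
by rewrite !empty ?cards0 // => x; rewrite /flip; case: (c _) (c _) => [] [].
Qed.

(** * Reduction to connected graphs *)

(** Connectivity without paths: a vertex set that no edge crosses is empty or full. In this form it
    turns a property preserved along edges directly into a constant one. *)
Definition connected_graph (T : finType) (e : rel T) : Prop :=
  forall S : pred T, (forall x y, e x y -> S x = S y) ->
  forall x y, S x = S y.

(** Induction on the number of vertices: a proper nonempty set [S] crossed by no edge splits both
    counts into products over two smaller graphs. *)
Lemma color_homs_flip_connected (W : finType) (r : rel W) (col : W -> bool) :
  (forall (T : finType) (e : rel T) c, connected_graph e ->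
     #|color_homs e r col c| = #|color_homs e r col (flip c)|) ->
  forall (T : finType) (e : rel T) c,
    #|color_homs e r col c| = #|color_homs e r col (flip c)|.
Proof.
move=> conn_eq T; have [N] := ubnP #|T|; elim: N T => // N IH T ltTN e c.
have [/existsP[S]|] := boolP [exists S : {set T},
    [&& [forall x, forall y, e x y ==> ((x \in S) == (y \in S))],
        S != set0 & S != setT]]; last first.
  rewrite negb_exists => /forallP noS; apply: conn_eq => P closedP x y.
  have := noS [set z | P z]; rewrite !negb_and.
  case/or3P=> [/negP[]|/negPn/eqP/setP E|/negPn/eqP/setP E].
  - by apply/'forall_forallP=> u v; apply/implyP=> /closedP; rewrite !inE => ->.
  - by have := E x; have := E y; rewrite !inE => -> ->.
  - by have := E x; have := E y; rewrite !inE => -> ->.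
case/and3P=> /'forall_forallP closedS /set0Pn[x xS] Sn1.
have [y yS] : exists y, y \notin S.
  by apply/existsP; rewrite -negb_forall; apply: contra Sn1 => /forallP h;
     apply/eqP/setP=> z; rewrite h inE.
have closedP u v : e u v -> (u \in S) = (v \in S).
  by move=> euv; apply/eqP; move: (closedS u v); rewrite euv.
rewrite !(card_color_homs_split _ _ _ closedP); congr (_ * _).
  apply: IH; apply: (@leq_trans #|T|); [rewrite card_sig | exact: ltTN].
  by apply: proper_card; rewrite properE subset_predT; apply/subsetPn; exists y.
apply: IH; apply: (@leq_trans #|T|); [rewrite card_sig | exact: ltTN].
apply: proper_card; rewrite properE subset_predT; apply/subsetPn; exists x => //.
by rewrite inE negbK.
Qed.

(** * Homomorphisms into the coloured products *)

(* [b] tells whether the pairs of equal ([false]) or of opposite ([true])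
   colours are kept. *)
Record is_color_product (W1 W2 A : finType) (r1 : rel W1) (r2 : rel W2)
    (col1 : W1 -> bool) (col2 : W2 -> bool) (b : bool) (rA : rel A)
    (pi1 : A -> W1) (pi2 : A -> W2) : Prop := IsColorProduct {
  cp_inj : forall a a', pi1 a = pi1 a' -> pi2 a = pi2 a' -> a = a';
  cp_col : forall a, col2 (pi2 a) = col1 (pi1 a) (+) b;
  cp_surj : forall w1 w2, col2 w2 = col1 w1 (+) b ->
              exists a, pi1 a = w1 /\ pi2 a = w2;
  cp_rel : forall a a', rA a a' = r1 (pi1 a) (pi1 a') && r2 (pi2 a) (pi2 a') }.

Section ProductHoms.
Variables (W1 W2 : finType) (r1 : rel W1) (r2 : rel W2).
Variables (col1 : W1 -> bool) (col2 : W2 -> bool).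
Hypotheses (pr1 : proper_coloring r1 col1) (pr2 : proper_coloring r2 col2).

Section OneProduct.
Variables (A : finType) (b : bool) (rA : rel A) (pi1 : A -> W1) (pi2 : A -> W2).
Hypothesis prodA : is_color_product r1 r2 col1 col2 b rA pi1 pi2.

(** The neighbourhood of [a] is the full product of the neighbourhoods of its projections: both
    colours change along an edge, so the colour relation fixed by [b] persists. *)
Lemma degree_color_product a :
  degree rA a = degree r1 (pi1 a) * degree r2 (pi2 a).
Proof.
rewrite /degree -cardsX.
have h_inj : injective (fun x => (pi1 x, pi2 x)).
  by move=> x y [h1 h2]; apply: (cp_inj prodA).
rewrite -(card_imset _ h_inj); apply: eq_card => -[w1 w2].
apply/imsetP/setXP => [[x]|[]]; rewrite !inE.
  by rewrite (cp_rel prodA) => /andP[? ?] [-> ->].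
move=> h1 h2; have [|x [x1 x2]] := cp_surj prodA (w1 := w1) (w2 := w2).
  by rewrite (pr1 h1) (pr2 h2) (cp_col prodA) addNb.
by exists x; rewrite ?inE ?(cp_rel prodA) x1 x2 ?h1.
Qed.

Variables (T : finType) (e : rel T) (u : T).
Hypothesis conn_e : connected_graph e.

(** An isomorphism of the products need not respect colours, but it preserves the degree of the
    image of [u]. *)
Definition homs_degree (d : nat) :=
  [set f : {ffun T -> A} | [forall x, forall y, e x y ==> rA (f x) (f y)]
                           && (degree rA (f u) == d)].

(** The factor [k] stands for the degree of the first coordinate of the image of [u], so that [d] is
    the degree in the product. *)
Definition color_homs_degree (k d : nat) (c : T -> bool) :=
  [set f in color_homs e r2 col2 c | k * degree r2 (f u) == d].

Variable deg1 : bool -> nat.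
Hypothesis deg1E : forall w, degree r1 w = deg1 (col1 w).

(** A homomorphism to the product is a pair of homomorphisms to the factors. By connectedness the
    first one has colouring [c] or [flip c], and [b] then determines the colouring of the second. *)
Lemma card_homs_degree d c : proper_coloring e c ->
  #|homs_degree d| =
    #|color_homs e r1 col1 c|
      * #|color_homs_degree (deg1 (c u)) d (fun x => c x (+) b)|
  + #|color_homs e r1 col1 (flip c)|
      * #|color_homs_degree (deg1 (flip c u)) d (fun x => flip c x (+) b)|.
Proof.
move=> pc.
pose h (f : {ffun T -> A}) := ([ffun x => pi1 (f x)], [ffun x => pi2 (f x)]).
have h_inj : injective h.
  move=> f g [/ffunP h1 /ffunP h2]; apply/ffunP=> x.
  by apply: (cp_inj prodA); [have := h1 x | have := h2 x]; rewrite !ffunE.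
rewrite -(card_imset _ h_inj) -!cardsX -cardsUI.
(* The two families are disjoint: their first coordinates colour [u] differently. *)
rewrite [X in _ + X](_ : _ = 0) ?addn0; last first.
  apply/eqP; rewrite cards_eq0; apply/eqP/setP=> -[f g]; rewrite [RHS]inE.
  apply/negP=> /setIP[/setXP[/color_homsP[_ f1] _] /setXP[/color_homsP[_ f2] _]].
  by have := f2 u; rewrite f1 /flip; case: (c u).
apply: eq_card => -[f g].
have homs_to c' : f \in color_homs e r1 col1 c' ->
    g \in color_homs_degree (deg1 (c' u)) d (fun x => c' x (+) b) ->
    exists2 F, F \in homs_degree d & (f, g) = h F.
  move=> /color_homsP[f1 f2]; rewrite inE => /andP[/color_homsP[g1 g2] /eqP gd].
  have /fin_all_exists[F FE] x : exists a, pi1 a = f x /\ pi2 a = g x.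
    by apply: (cp_surj prodA); rewrite f2 g2.
  exists (finfun F); last first.
    by congr (_, _); apply/ffunP=> x; rewrite !ffunE; case: (FE x).
  rewrite inE; apply/andP; split.
    apply/'forall_forallP=> x y; apply/implyP=> exy; rewrite !ffunE (cp_rel prodA).
    by case: (FE x) (FE y) => -> -> [-> ->]; rewrite f1 ?g1.
  by rewrite ffunE degree_color_product; case: (FE u) => -> ->; rewrite deg1E f2 gd.
apply/imsetP/setUP => [[F]|[/setXP[fc gc]|/setXP[fc gc]]]; try exact: homs_to gc.
rewrite inE => /andP[/'forall_forallP F1 /eqP FD] FE.
have F2 x y : e x y -> rA (F x) (F y) by apply/implyP.
have {FE} [-> ->] : f = [ffun x => pi1 (F x)] /\ g = [ffun x => pi2 (F x)].
  by case: FE.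
have mem c' : (forall x, col1 (pi1 (F x)) = c' x) ->
  (([ffun x => pi1 (F x)], [ffun x => pi2 (F x)]) \in
     setX (color_homs e r1 col1 c')
          (color_homs_degree (deg1 (c' u)) d (fun x => c' x (+) b))).
  move=> cc'; apply/setXP; split.
    apply/color_homsP; split=> [x y /F2|x]; rewrite !ffunE ?cc' //.
    by rewrite (cp_rel prodA) => /andP[].
  rewrite inE; apply/andP; split.
    apply/color_homsP; split=> [x y /F2|x]; rewrite !ffunE.
      by rewrite (cp_rel prodA) => /andP[].
    by rewrite (cp_col prodA) cc'.
  by rewrite !ffunE -FD degree_color_product deg1E cc'.
(* Both colours change along an edge, so agreement with [c] at one vertex spreads to all of them. *)
have closedF x y : e x y ->
    (col1 (pi1 (F x)) == c x) = (col1 (pi1 (F y)) == c y).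
  move=> exy; have := F2 _ _ exy; rewrite (cp_rel prodA) => /andP[/pr1 -> _].
  by rewrite (pc _ _ exy); case: (c x) (col1 _) => [] [].
have const := conn_e closedF.
have [Fu|Fu] := boolP (col1 (pi1 (F u)) == c u); [left|right]; apply: mem => x.
  by apply/eqP; rewrite (const x u).
move: Fu; rewrite -(const x u) /flip.
by case: (c x) (col1 _) => [] [].
Qed.

End OneProduct.

Variables (A A' : finType) (rA : rel A) (rA' : rel A').
Variables (pi1 : A -> W1) (pi2 : A -> W2) (pi1' : A' -> W1) (pi2' : A' -> W2).
Hypothesis prodA : is_color_product r1 r2 col1 col2 false rA pi1 pi2.
Hypothesis prodA' : is_color_product r1 r2 col1 col2 true rA' pi1' pi2'.

Lemma degree_iso (F : A -> A') a :
  is_graph_iso rA rA' F -> degree rA' (F a) = degree rA a.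
Proof.
move=> [Fbij FE]; rewrite /degree -(card_imset _ (bij_inj Fbij)).
apply: eq_card => y; rewrite inE; apply/idP/imsetP => [ry|[x]].
  by case: Fbij => G FK GK; exists (G y); rewrite ?inE -?FE GK.
by rewrite inE => rx ->; rewrite FE.
Qed.

Variables (F : A -> A').
Hypothesis isoF : is_graph_iso rA rA' F.

Lemma card_homs_degree_iso (T : finType) (e : rel T) u d :
  #|homs_degree rA e u d| = #|homs_degree rA' e u d|.
Proof.
have [Fbij FE] := isoF.
pose h (f : {ffun T -> A}) := [ffun x => F (f x)].
have h_inj : injective h.
  move=> f g /ffunP fg; apply/ffunP=> x; apply: (bij_inj Fbij).
  by have := fg x; rewrite !ffunE.
rewrite -(card_imset _ h_inj); apply: eq_card => g; rewrite [RHS]inE.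
apply/imsetP/andP => [[f]|[/'forall_forallP g1 gd]].
  rewrite inE => /andP[/'forall_forallP f1 fd] ->; split.
    by apply/'forall_forallP=> x y; rewrite !ffunE FE.
  by rewrite ffunE degree_iso.
have [G FK GK] := Fbij; exists [ffun x => G (g x)]; last first.
  by apply/ffunP=> x; rewrite !ffunE GK.
rewrite inE ffunE; apply/andP; split.
  by apply/'forall_forallP=> x y; rewrite !ffunE -FE !GK.
by rewrite -(degree_iso _ isoF) GK.
Qed.

Variables (deg1 : bool -> nat) (w w' : W1).
Hypothesis deg1E : forall w, degree r1 w = deg1 (col1 w).
Hypotheses (sym1 : symmetric r1) (r1ww' : r1 w w').
Hypothesis deg1_neq : deg1 true != deg1 false.
Hypothesis no_isolated2 : no_isolated r2.

Lemma deg1_gt0 b : 0 < deg1 b.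
Proof.
have [v [v' [rv <-]]] : exists v v', r1 v v' /\ col1 v = b.
  have [<-|wb] := eqVneq (col1 w) b; first by exists w, w'.
  exists w', w; rewrite sym1 (pr1 r1ww'); split=> //.
  by move: wb; case: b (col1 w) => [] [].
by rewrite -deg1E; apply/card_gt0P; exists v'; rewrite inE.
Qed.

Lemma color_homs1_gt0 (T : finType) (e : rel T) c :
  proper_coloring e c -> 0 < #|color_homs e r1 col1 c|.
Proof.
move=> pc; have := pr1 r1ww'; case: (boolP (col1 w)) => cw cw'.
  by apply: color_homs_gt0 pc sym1 r1ww' cw _; rewrite cw'.
have cw1 : col1 w' by rewrite cw'.
by apply: color_homs_gt0 pc sym1 _ cw1 cw; rewrite sym1.
Qed.

(** Strong induction on [d]. Write a < a' for the degrees [deg1 (c u)] and [deg1 (flip c u)], and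
    compare both products at degree a * d. The terms with a count degree [d] in the second factor;
    those with a' count a smaller degree, agree by induction and cancel. The common factor left,
    counting homomorphisms to the first graph, is positive. *)
Lemma card_color_homs_degree_flip (T : finType) (e : rel T) c u d :
  connected_graph e -> proper_coloring e c -> deg1 (c u) < deg1 (flip c u) ->
  #|color_homs_degree e u 1 d c| = #|color_homs_degree e u 1 d (flip c)|.
Proof.
move=> conn_e pc ltk; have [N] := ubnP d; elim: N d => // N IH d ltdN.
have [-> {d ltdN}|d_gt0] := posnP d.
  have empty c' : color_homs_degree e u 1 0 c' = set0.
    apply/setP=> f; rewrite !inE mul1n; apply/negP=> /andP[_].
    by rewrite cards_eq0 => /eqP/setP h; have [y ry] := no_isolated2 (f u);
       have := h y; rewrite !inE ry.
  by rewrite !empty.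
pose s := deg1 (c u) * d.
have scale c' : color_homs_degree e u (deg1 (c u)) s c'
                = color_homs_degree e u 1 d c'.
  by apply/setP=> f; rewrite !inE mul1n /s eqn_pmul2l ?deg1_gt0.
have small : #|color_homs_degree e u (deg1 (flip c u)) s c|
             = #|color_homs_degree e u (deg1 (flip c u)) s (flip c)|.
  (* If a' divides [s], the quotient is below [d] because a < a'; otherwise no vertex can have the
     required degree. *)
  have [/dvdnP[d' sE]|ndvd] := boolP (deg1 (flip c u) %| s).
    have ltd' : d' < d.
      rewrite -(ltn_pmul2l (deg1_gt0 (flip c u))) mulnC -sE /s.
      by rewrite ltn_pmul2r.
    have unscale c' : color_homs_degree e u (deg1 (flip c u)) s c'
                    = color_homs_degree e u 1 d' c'.
      by apply/setP=> f; rewrite !inE mul1n sE mulnC eqn_pmul2r ?deg1_gt0.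
    by rewrite !unscale; apply: IH; apply: leq_trans ltd' _.
  have empty c' : color_homs_degree e u (deg1 (flip c u)) s c' = set0.
    apply/setP=> f; rewrite !inE; apply: contraNF ndvd => /andP[_ /eqP<-].
    exact: dvdn_mulr.
  by rewrite !empty.
have eqc k c1 c2 : c1 =1 c2 ->
    color_homs_degree e u k s c1 = color_homs_degree e u k s c2.
  by move=> c12; rewrite /color_homs_degree (eq_color_homs _ _ _ c12).
have := card_homs_degree_iso e u s.
rewrite (card_homs_degree prodA _ conn_e deg1E _ pc).
rewrite (card_homs_degree prodA' _ conn_e deg1E _ pc).
rewrite (eqc _ _ c) => [|x]; last by rewrite addbF.
rewrite (eqc _ (fun x => flip c x (+) false) (flip c)) => [|x]; last by rewrite addbF.
rewrite (eqc _ (fun x => c x (+) true) (flip c)) => [|x]; last by rewrite addbT.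
rewrite (eqc _ (fun x => flip c x (+) true) c) => [|x]; last first.
  by rewrite addbT /flip negbK.
rewrite small !scale => /addIn/eqP.
by rewrite eqn_pmul2l ?color_homs1_gt0 // => /eqP.
Qed.

(** For connected graphs, sum over the degree of the image of a marked vertex [u]. As [deg1] takes
    distinct values, one of [c] and [flip c] satisfies the strict inequality of the previous
    lemma. *)
Lemma card_color_homs_flip (T : finType) (e : rel T) c :
  #|color_homs e r2 col2 c| = #|color_homs e r2 col2 (flip c)|.
Proof.
move: T e c; apply: color_homs_flip_connected => T e c conn_e.
have flipK : flip (flip c) =1 c by move=> x; rewrite /flip negbK.
have [u _|T0] := pickP T; last first.
  by congr #|pred_of_set _|; apply: eq_color_homs => x; have := T0 x.
(* Either both counts vanish, or some homomorphism exists and makes [c] proper. *)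
have [/existsP[f fc]|no_hom] := boolP [exists f,
    f \in color_homs e r2 col2 c :|: color_homs e r2 col2 (flip c)]; last first.
  rewrite negb_exists in no_hom; move/forallP: no_hom => no_hom.
  by rewrite !eq_card0 // => f; apply/negbTE; have := no_hom f;
     rewrite in_setU negb_or => /andP[].
have pc : proper_coloring e c.
  case/setUP: fc => /(color_homs_proper pr2) // pc x y /pc.
  by rewrite /flip; case: (c x) (c y) => [] [].
have pc' : proper_coloring e (flip c) by move=> x y /pc; rewrite /flip => ->.
have degE d :
    #|color_homs_degree e u 1 d c| = #|color_homs_degree e u 1 d (flip c)|.
  case: (ltngtP (deg1 (c u)) (deg1 (flip c u))) => [lt|gt|eqk].
  - exact: card_color_homs_degree_flip.
  - rewrite [RHS]card_color_homs_degree_flip ?flipK //.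
    by rewrite /color_homs_degree (eq_color_homs _ _ _ flipK).
  - by have := deg1_neq; move: eqk; rewrite /flip; case: (c u) => ->; rewrite eqxx.
(* A degree is at most [#|W2|], so [inord] does not alter it. *)
pose deg_of (f : {ffun T -> W2}) : 'I_(#|W2|.+1) := inord (degree r2 (f u)).
have part c' : #|color_homs e r2 col2 c'|
             = \sum_(d < #|W2|.+1) #|color_homs_degree e u 1 d c'|.
  rewrite -sum1_card (partition_big deg_of xpredT) //=.
  apply: eq_bigr => i _; rewrite -[RHS]sum1_card; apply: eq_bigl => g.
  rewrite [RHS]inE mul1n -val_eqE /= inordK // ltnS.
  exact: max_card.
by rewrite !part; apply: eq_bigr => d _.
Qed.

(** The identity is an injective colour-preserving homomorphism of the second graph to itself, so an
    injective colour-reversing one exists too. *)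
Lemma color_reversing_automorphism :
  exists s : W2 -> W2, [/\ injective s, forall x y, r2 (s x) (s y) = r2 x y
    & forall x, col2 (s x) = ~~ col2 x].
Proof.
have := color_homs_flip_inj card_color_homs_flip r2 col2.
set N := #|_| => NE.
have : 0 < N.
  apply/card_gt0P; exists [ffun x => x]; apply/kernel_homs1P; split.
    by apply/color_homsP; split=> [x y|x]; rewrite !ffunE.
  by move=> x y; rewrite !ffunE.
rewrite NE => /card_gt0P[s /kernel_homs1P[/color_homsP[s1 s2] s_inj]].
exists s; split=> // x y; apply/idP/idP => [rs|/s1//].
(* An injective endomorphism permutes the finite set of edges, hence also reflects edges. *)
pose h (z : W2 * W2) := (s z.1, s z.2).
have h_inj : injective h by move=> [a b] [a' b'] [/s_inj-> /s_inj->].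
have : h @: [set z | r2 z.1 z.2] = [set z | r2 z.1 z.2].
  apply/eqP; rewrite eqEcard (card_imset _ h_inj) leqnn andbT.
  by apply/subsetP=> v /imsetP[z]; rewrite inE => rz ->; rewrite inE s1.
move/setP/(_ (s x, s y)); rewrite [RHS]inE /= rs => /imsetP[[x' y']].
by rewrite inE /= => rxy [/s_inj-> /s_inj->].
Qed.

Lemma color_product_iso : exists g : A -> A',
  is_graph_iso rA rA' g /\ forall a, col1 (pi1' (g a)) = col1 (pi1 a).
Proof.
have [s [s_inj sE sC]] := color_reversing_automorphism.
have /fin_all_exists[g gE] a : exists a', pi1' a' = pi1 a /\ pi2' a' = s (pi2 a).
  by apply: (cp_surj prodA'); rewrite sC (cp_col prodA) addbF addbT.
exists g; split=> [|a]; last by case: (gE a) => ->.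
split=> [|x y]; last first.
  rewrite (cp_rel prodA) (cp_rel prodA').
  by case: (gE x) (gE y) => -> -> [-> ->]; rewrite sE.
(* The given isomorphism [F] supplies the equality of cardinals. *)
apply: inj_card_bij; last by rewrite (bij_eq_card isoF.1).
move=> x y gxy; have [x1 x2] := gE x; have [y1 y2] := gE y.
by apply: (cp_inj prodA); [rewrite -x1 gxy | apply: s_inj; rewrite -x2 gxy].
Qed.

End ProductHoms.

(** * Sides of a bipartite graph as colours *)

Definition in_rows (a b : nat) (x : 'I_(a + b)) : bool :=
  if split x is inl _ then true else false.

Lemma in_rows_lshift a b (i : 'I_a) : in_rows (lshift b i).
Proof. by rewrite /in_rows (unsplitK (inl i)). Qed.

Lemma in_rows_rshift a b (j : 'I_b) : in_rows (rshift a j) = false.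
Proof. by rewrite /in_rows (unsplitK (inr j)). Qed.

Definition in_rowsE := (in_rows_lshift, in_rows_rshift).

Lemma mem_row_part a b (x : 'I_(a + b)) : (x \in row_part a b) = in_rows x.
Proof.
case: (split_ordP x) => i ->; rewrite in_rowsE.
  by apply/imsetP; exists i.
apply/imsetP=> -[j _ /(congr1 (@in_rows a b))].
by rewrite !in_rowsE.
Qed.

Lemma mem_col_part a b (x : 'I_(a + b)) : (x \in col_part a b) = ~~ in_rows x.
Proof.
case: (split_ordP x) => i ->; rewrite in_rowsE; last by apply/imsetP; exists i.
apply/imsetP=> -[j _ /(congr1 (@in_rows a b))].
by rewrite !in_rowsE.
Qed.

Section BiadjacencyGraph.
Variables (a b : nat) (V : 'M[int]_(a, b)).

Lemma biadj_ll i i' : graph_of (biadj_mx V) (lshift b i) (lshift b i') = false.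
Proof. by rewrite /graph_of /= block_mxEul mxE. Qed.

Lemma biadj_lr i j :
  graph_of (biadj_mx V) (lshift b i) (rshift a j) = (V i j == 1%R).
Proof. by rewrite /graph_of /= block_mxEur. Qed.

Lemma biadj_rl i j :
  graph_of (biadj_mx V) (rshift a j) (lshift b i) = (V i j == 1%R).
Proof. by rewrite /graph_of /= block_mxEdl mxE. Qed.

Lemma biadj_rr j j' : graph_of (biadj_mx V) (rshift a j) (rshift a j') = false.
Proof. by rewrite /graph_of /= block_mxEdr mxE. Qed.

Definition biadjE := (biadj_ll, biadj_lr, biadj_rl, biadj_rr).

Lemma biadj_sym : symmetric (graph_of (biadj_mx V)).
Proof.
by move=> x y; case: (split_ordP x) => i ->; case: (split_ordP y) => j ->;
   rewrite !biadjE.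
Qed.

Lemma biadj_proper : proper_coloring (graph_of (biadj_mx V)) (@in_rows a b).
Proof.
by move=> x y; case: (split_ordP x) => i ->; case: (split_ordP y) => j ->;
   rewrite !biadjE ?in_rowsE.
Qed.

End BiadjacencyGraph.

(** * Partitioned tensor products as coloured products *)

Section TensorProducts.
Variables (m n p q : nat) (V : 'M[int]_(m, n)) (B : 'M[int]_(p, q)).
Hypotheses (V01 : zero_one_mx V) (B01 : zero_one_mx B).

(** Over the integers, restricting entries to 0 and 1 excludes the product of -1 with itself. *)
Lemma tens_eq1 i j a b :
  (V i j * B a b == 1)%R = (V i j == 1%R) && (B a b == 1%R).
Proof.
move/'forall_forallP/(_ i j): V01; move/'forall_forallP/(_ a b): B01.
by case/orP=> /eqP-> /orP[] /eqP->.
Qed.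

Definition pi1 (x : 'I_(m * p + n * q)) : 'I_(m + n) :=
  match split x with
  | inl i => lshift n (mxtens_unindex i).1
  | inr j => rshift m (mxtens_unindex j).1
  end.

Definition pi2 (x : 'I_(m * p + n * q)) : 'I_(p + q) :=
  match split x with
  | inl i => lshift q (mxtens_unindex i).2
  | inr j => rshift p (mxtens_unindex j).2
  end.

Definition pi1_sharp (x : 'I_(m * q + n * p)) : 'I_(m + n) :=
  match split x with
  | inl i => lshift n (mxtens_unindex i).1
  | inr j => rshift m (mxtens_unindex j).1
  end.

(** A row of [V *t B^T] pairs a row of [V] with a column of [B]. Exchanging the sides here keeps the
    graph of [biadj_mx B] as second factor of both products. *)
Definition pi2_sharp (x : 'I_(m * q + n * p)) : 'I_(p + q) :=
  match split x with
  | inl i => rshift p (mxtens_unindex i).2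
  | inr j => lshift q (mxtens_unindex j).2
  end.

Lemma pi1_l i a : pi1 (lshift _ (mxtens_index (i, a))) = lshift n i.
Proof. by rewrite /pi1 (unsplitK (inl _)) mxtens_indexK. Qed.
Lemma pi1_r j b : pi1 (rshift _ (mxtens_index (j, b))) = rshift m j.
Proof. by rewrite /pi1 (unsplitK (inr _)) mxtens_indexK. Qed.
Lemma pi2_l i a : pi2 (lshift _ (mxtens_index (i, a))) = lshift q a.
Proof. by rewrite /pi2 (unsplitK (inl _)) mxtens_indexK. Qed.
Lemma pi2_r j b : pi2 (rshift _ (mxtens_index (j, b))) = rshift p b.
Proof. by rewrite /pi2 (unsplitK (inr _)) mxtens_indexK. Qed.
Lemma pi1_sharp_l i b : pi1_sharp (lshift _ (mxtens_index (i, b))) = lshift n i.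
Proof. by rewrite /pi1_sharp (unsplitK (inl _)) mxtens_indexK. Qed.
Lemma pi1_sharp_r j a : pi1_sharp (rshift _ (mxtens_index (j, a))) = rshift m j.
Proof. by rewrite /pi1_sharp (unsplitK (inr _)) mxtens_indexK. Qed.
Lemma pi2_sharp_l i b : pi2_sharp (lshift _ (mxtens_index (i, b))) = rshift p b.
Proof. by rewrite /pi2_sharp (unsplitK (inl _)) mxtens_indexK. Qed.
Lemma pi2_sharp_r j a : pi2_sharp (rshift _ (mxtens_index (j, a))) = lshift q a.
Proof. by rewrite /pi2_sharp (unsplitK (inr _)) mxtens_indexK. Qed.

Definition piE := (pi1_l, pi1_r, pi2_l, pi2_r,
                   pi1_sharp_l, pi1_sharp_r, pi2_sharp_l, pi2_sharp_r).

Variant tens_ord_spec (a b c d : nat) : 'I_(a * b + c * d) -> Type :=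
  | TensRow i j : tens_ord_spec (lshift _ (mxtens_index (i, j)))
  | TensCol i j : tens_ord_spec (rshift _ (mxtens_index (i, j))).

Lemma tens_ordP a b c d (x : 'I_(a * b + c * d)) : tens_ord_spec x.
Proof.
case: (split_ordP x) => i ->; rewrite -[i]mxtens_unindexK.
  by case: (mxtens_unindex i) => *; constructor.
by case: (mxtens_unindex i) => *; constructor.
Qed.

Lemma color_product_ptens :
  is_color_product (graph_of (biadj_mx V)) (graph_of (biadj_mx B))
    (@in_rows m n) (@in_rows p q) false
    (graph_of (ptens (biadj_mx V) (biadj_mx B))) pi1 pi2.
Proof.
rewrite ptens_biadj; split.
- move=> x y; case: (tens_ordP x) => i a; case: (tens_ordP y) => j b; rewrite !piE.
  + by move=> /lshift_inj-> /lshift_inj->.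
  + by move/eqP; rewrite eq_lrshift.
  + by move/eqP; rewrite eq_rlshift.
  + by move=> /rshift_inj-> /rshift_inj->.
- by move=> x; case: (tens_ordP x) => i a; rewrite !piE !in_rowsE.
- move=> x y; case: (split_ordP x) => i ->; case: (split_ordP y) => j ->;
    rewrite !in_rowsE //= => _.
    by exists (lshift _ (mxtens_index (i, j))); rewrite !piE.
  by exists (rshift _ (mxtens_index (i, j))); rewrite !piE.
- move=> x y; case: (tens_ordP x) => i a; case: (tens_ordP y) => j b;
    by rewrite !piE !biadjE ?tensmxE ?tens_eq1.
Qed.

Lemma color_product_ptens_sharp :
  is_color_product (graph_of (biadj_mx V)) (graph_of (biadj_mx B))
    (@in_rows m n) (@in_rows p q) true
    (graph_of (ptens (biadj_mx V) (biadj_sharp_mx B))) pi1_sharp pi2_sharp.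
Proof.
rewrite ptens_biadj_sharp; split.
- move=> x y; case: (tens_ordP x) => i a; case: (tens_ordP y) => j b; rewrite !piE.
  + by move=> /lshift_inj-> /rshift_inj->.
  + by move/eqP; rewrite eq_lrshift.
  + by move/eqP; rewrite eq_rlshift.
  + by move=> /rshift_inj-> /lshift_inj->.
- by move=> x; case: (tens_ordP x) => i a; rewrite !piE !in_rowsE.
- move=> x y; case: (split_ordP x) => i ->; case: (split_ordP y) => j ->;
    rewrite !in_rowsE //= => _.
    by exists (lshift _ (mxtens_index (i, j))); rewrite !piE.
  by exists (rshift _ (mxtens_index (i, j))); rewrite !piE.
- move=> x y; case: (tens_ordP x) => i a; case: (tens_ordP y) => j b;
    by rewrite !piE !biadjE ?tensmxE ?mxE ?tens_eq1.
Qed.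

Lemma in_rows_pi1 x : in_rows (pi1 x) = in_rows x.
Proof. by case: (tens_ordP x) => i a; rewrite piE !in_rowsE. Qed.

Lemma in_rows_pi1_sharp x : in_rows (pi1_sharp x) = in_rows x.
Proof. by case: (tens_ordP x) => i a; rewrite piE !in_rowsE. Qed.

End TensorProducts.

Theorem theorem4p5 (m n p q : nat)
    (V : 'M[int]_(m, n)) (B : 'M[int]_(p, q)) (k l : nat) :
  zero_one_mx V ->
  zero_one_mx B ->
  no_isolated (graph_of (biadj_mx V)) ->
  no_isolated (graph_of (biadj_mx B)) ->
  nonempty_graph (graph_of (biadj_mx V)) ->
  biregular (graph_of (biadj_mx V)) (row_part m n) (col_part m n) k l ->
  k <> l ->
  property_eta V B.
Proof.
move=> V01 B01 _ isoB [w [w1 rww1]] bireg /eqP kl; rewrite /property_eta; case=> f isof.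
(* Either side may carry degree [k]; [deg1] absorbs both cases. *)
have [deg1 deg1_neq deg1E] : exists2 deg1 : bool -> nat,
    deg1 true != deg1 false &
    forall x, degree (graph_of (biadj_mx V)) x = deg1 (in_rows x).
  case: bireg => -[hX hY].
    exists (fun b => if b then k else l) => // x.
    by case: ifP => xr; [apply: hX; rewrite mem_row_part
                        | apply: hY; rewrite mem_col_part xr].
  exists (fun b => if b then l else k) => [|x]; first by rewrite eq_sym.
  by case: ifP => xr; [apply: hY; rewrite mem_row_part
                      | apply: hX; rewrite mem_col_part xr].
have [g [isog gC]] := color_product_iso
  (@biadj_proper _ _ V) (@biadj_proper _ _ B)
  (color_product_ptens V01 B01) (color_product_ptens_sharp V01 B01)
  isof deg1E (@biadj_sym _ _ V) rww1 deg1_neq isoB.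
have gR x : in_rows (g x) = in_rows x by rewrite -in_rows_pi1_sharp gC in_rows_pi1.
(* Since [g] keeps the first projection's colour, rows go to rows. *)
exists g; split=> //; left.
have [h gK hK] := isog.1.
have im_g (X : {set _}) (Y : {set _}) :
    (forall x, (g x \in Y) = (x \in X)) -> g @: X = Y.
  move=> XY; apply/setP=> y; apply/imsetP/idP => [[x xX ->]|yY].
    by rewrite XY.
  by exists (h y); rewrite ?hK // -XY hK.
by split; apply: im_g => x; rewrite !(mem_row_part, mem_col_part) gR.
Qed.
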